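(* Let $M$ be an $n$-dimensional smooth manifold, $(E,\tau,I)$ a para-Hermitian vector bundle of rank $2n$ on $M$, $\Phi:TM\to E$ a bundle map such that for every $p\in M$, $\mathrm{rank}\,\Phi_p=n$ and $\Phi_p(T_pM)$ is a Lagrange subspace of $E_p$, $\nabla^{+}$ a connection on $E^{+}$ and $\nabla^{-}$ its dual connection on $E^{-}$. Let $h$, $C$, $\Gamma$ be the associated symmetric $(0,2)$-tensor, $(0,3)$-tensor and Kossowski pseudo-connection. Consider the conditions: (i) $\nabla^{+}$ is relatively torsion-free, i.e. $T^{\nabla^{+}}\equiv 0$; (ii) $\nabla^{-}$ is relatively torsion-free, i.e. $T^{\nabla^{-}}\equiv 0$; (iii) $C$ is totally symmetric, i.e. $C(X,Y,Z)=C(Y,X,Z)$ for all $X,Y,Z\in\Gamma(TM)$; (iv) $\Gamma(X,Y,Z)=\tau(\nabla^{+}_X\Phi^{+}(Y),\Phi^{-}(Z))+\tau(\Phi^{+}(Z),\nabla^{-}_X\Phi^{-}(Y))$ for all $X,Y,Z\in\Gamma(TM)$. Then: (1) If (i) and (ii) are satisfied, then (iii) and (iv) are satisfied. (2) If $\Phi^{+}$ is an isomorphism, (i) is satisfied, and either (iii) or (iv) is satisfied, then (ii) is satisfied. (3) If $\Phi^{-}$ is an isomorphism, (ii) is satisfied, and either (iii) or (iv) is satisfied, then (i) is satisfied. (4) If $h$ is non-degenerate and any two of the conditions (i)--(iv) are satisfied, then the remaining ones are satisfied.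
   Context: Everything is $C^\infty$. A para-Hermitian vector bundle on $M$ ($\dim M=n$) is a triple $(E,\tau,I)$ where $E\to M$ is a vector bundle of rank $2n$, $\tau$ is a pseudo-Riemannian metric on the bundle $E$ (smooth fiberwise non-degenerate symmetric bilinear form), and $I:E\to E$ is a bundle map with (a) $I^2=\mathrm{id}$, $I\ne\mathrm{id}$; (b) the eigenbundles $E^{+}$, $E^{-}$ of $I$ for the eigenvalues $1$, $-1$ have the same rank and $E=E^{+}\oplus E^{-}$; (c) $\tau(IX,Y)+\tau(X,IY)=0$. Put $\omega(X,Y):=\tau(X,IY)$; a subspace of $E_p$ of dimension $n$ is Lagrangian if $\omega$ vanishes on it. $\pi^{\pm}:E\to E^{\pm}$ are the projections and $\Phi^{\pm}:=\pi^{\pm}\circ\Phi$. The dual connection $\nabla^{-}$ on $E^{-}$ is defined by $X\tau(\nu^{+},\nu^{-})=\tau(\nabla^{+}_X\nu^{+},\nu^{-})+\tau(\nu^{+},\nabla^{-}_X\nu^{-})$ for $X\in\Gamma(TM)$, $\nu^{\pm}\in\Gamma(E^{\pm})$. Relative torsion: $T^{\nabla^{\pm}}(X,Y):=\nabla^{\pm}_X\Phi^{\pm}(Y)-\nabla^{\pm}_Y\Phi^{\pm}(X)-\Phi^{\pm}([X,Y])$ for $X,Y\in\Gamma(TM)$. Induced tensor: $h(Y,Z):=\tau(\Phi(Y),\Phi(Z))$ (possibly degenerate). $C(X,Y,Z):=-2\{\tau(\nabla^{+}_X\Phi^{+}(Y),\Phi^{-}(Z))-\tau(\Phi^{+}(Z),\nabla^{-}_X\Phi^{-}(Y))\}$;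 it always satisfies $C(X,Y,Z)=C(X,Z,Y)$. Kossowski pseudo-connection: $\Gamma(X,Y,Z):=X\tau(\Phi^{+}(Y),\Phi^{-}(Z))+Y\tau(\Phi^{+}(Z),\Phi^{-}(X))-Z\tau(\Phi^{+}(X),\Phi^{-}(Y))-\tau(\Phi^{+}(X),\Phi^{-}([Y,Z]))+\tau(\Phi^{+}(Y),\Phi^{-}([Z,X]))+\tau(\Phi^{+}(Z),\Phi^{-}([X,Y]))$. *)

(* Defs.v *)
From HB Require Import structures.
From mathcomp Require Import all_boot all_order all_algebra.
From mathcomp Require Import all_classical all_reals all_analysis.
From mathcomp Require Import ring.
Set Implicit Arguments.
Unset Strict Implicit.
Unset Printing Implicit Defensive.
Import Order.TTheory GRing.Theory Num.Theory.
Import numFieldNormedType.Exports.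
Local Open Scope classical_set_scope.
Local Open Scope ring_scope.

Section Euclidean.
Context {R : realType} {n : nat}.
Implicit Types (U V : set 'rV[R]_n) (f g : 'rV[R]_n -> R).

(* C^k regularity on an open set U, via iterated partial derivatives *)
Fixpoint Ck (k : nat) U f : Prop :=
  if k is k'.+1 then
    (forall x, U x -> differentiable f x) /\
    (forall i, Ck k' U (fun x => 'D_(delta_mx 0 i) f x))
  else forall x, U x -> {for x, continuous f}.

Definition Cinfty U f := forall k, Ck k U f.

Lemma near_eq_differentiable f g x :
  (\near x, f x = g x) -> differentiable f x -> differentiable g x.
Proof.
move=> fg df.
have -> : g = f + (g - f) by rewrite addrC subrK.
apply: differentiableD => //.
set h := g - f.
have h0 : \near x, h x = 0.
  near do (rewrite /h !fctE; apply/eqP; rewrite subr_eq0 eq_sym; apply/eqP).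
  exact: fg.
have hx : h x = 0 by exact: nbhs_singleton h0.
have ho : h \o shift x = cst (h x) + (\0 : {linear 'rV[R]_n -> R}) +o_ 0 id.
  rewrite hx; apply/eqaddoP => e e0.
  have h0' : \forall y \near (0 : 'rV[R]_n), h (y + x) = 0.
    by move: h0; rewrite (near_shift 0 x) /= subr0.
  near=> y; rewrite /= !fctE /= /cst /= (near h0' y)//.
  by rewrite addr0 subr0 normr0 mulr_ge0// ltW.
have c0 : continuous (\0 : {linear 'rV[R]_n -> R}) by exact: cst_continuous.
have d0 := diff_unique c0 ho.
by apply/diff_locallyP; rewrite d0; split => //; exact: cst_continuous.
Unshelve. all: by end_near. Qed.

Lemma Ck_cover k U f :
  (forall x, U x -> exists2 V, V x & Ck k V f) -> Ck k U f.
Proof.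
elim: k f => [|k IH] f /= H.
  by move=> x /H[V Vx]; apply.
split=> [x /H[V Vx []]|i]; first by move/(_ x Vx).
by apply: IH => x /H[V Vx [_ /(_ i)]]; exists V.
Qed.

Lemma Ck_sub k U V f : V `<=` U -> Ck k U f -> Ck k V f.
Proof. by move=> VU Cf; apply: Ck_cover => x /VU Ux; exists U. Qed.

Lemma Ck_eq k U f g : open U -> {in U, f =1 g} -> Ck k U f -> Ck k U g.
Proof.
move=> oU; elim: k f g => [|k IH] f g fg /=.
  move=> cf x Ux; rewrite /prop_for/continuous_at.
  have fgx : \near x, f x = g x.
    by apply: filterS (open_nbhs_nbhs (conj oU Ux)) => y Uy; apply/fg/mem_set.
  rewrite -(nbhs_singleton fgx); apply: cvg_trans (cf x Ux).
  exact: near_eq_cvg fgx.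
have fgx x : U x -> \near x, f x = g x.
  move=> Ux; apply: filterS (open_nbhs_nbhs (conj oU Ux)) => y Uy.
  exact/fg/mem_set.
move=> [df Df]; split=> [x Ux|i].
  exact: near_eq_differentiable (fgx x Ux) (df x Ux).
apply: IH (Df i) => x /set_mem Ux.
exact/near_eq_derive/fgx.
Qed.

Lemma CkS k U f : Ck k.+1 U f -> Ck k U f.
Proof.
elim: k f => [|k IH] f /= [df Df].
  by move=> x /df; exact: differentiable_continuous.
by split=> // i; apply: IH.
Qed.

Lemma Ck_cst k U (a : R) : Ck k U (fun=> a).
Proof.
elim: k a => [|k IH] a /=; first by move=> x _; exact: cst_continuous.
split=> [x _|i]; first exact: differentiable_cst.
suff -> : (fun x : 'rV[R]_n => 'D_(delta_mx 0 i) (fun=> a) x) = (fun=> 0).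
  exact: IH.
by apply/funext => x; rewrite derive_cst.
Qed.

Lemma CkD k U f g : open U -> Ck k U f -> Ck k U g ->
  Ck k U (fun x => f x + g x).
Proof.
move=> oU; elim: k f g => [|k IH] f g /=.
  by move=> cf cg x Ux; apply: continuousD; [exact: cf|exact: cg].
move=> [df Df] [dg Dg]; split=> [x Ux|i].
  by apply: differentiableD; [exact: df|exact: dg].
apply: Ck_eq oU _ (IH _ _ (Df i) (Dg i)) => x /set_mem Ux /=.
rewrite -deriveD//; apply: diff_derivable; [exact: df|exact: dg].
Qed.

Lemma CkM k U f g : open U -> Ck k U f -> Ck k U g ->
  Ck k U (fun x => f x * g x).
Proof.
move=> oU; elim: k f g => [|k IH] f g.
  by move=> cf cg x Ux; apply: continuousM; [exact: cf|exact: cg].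
move=> Cf Cg; have [df Df] := Cf; have [dg Dg] := Cg; split=> [x Ux|i].
  by apply: differentiableM; [exact: df|exact: dg].
apply: Ck_eq oU _ (CkD oU (IH _ _ (CkS Cf) (Dg i)) (IH _ _ (CkS Cg) (Df i))).
move=> x /set_mem Ux /=.
rewrite -[RHS]/('D_(delta_mx 0 i) (f * g) x) deriveM//;
  apply: diff_derivable; [exact: df|exact: dg].
Qed.

End Euclidean.

Record chart (R : realType) (n : nat) (T : topologicalType) := Chart {
  cdom : set T;
  ccod : set 'rV[R]_n;
  cphi : T -> 'rV[R]_n;
  cpsi : 'rV[R]_n -> T;
  cdom_open : open cdom;
  ccod_open : open ccod;
  cphi_cod : {homo cphi : p / cdom p >-> ccod p};
  cpsi_dom : {homo cpsi : x / ccod x >-> cdom x};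
  cphiK : {in cdom, cancel cphi cpsi};
  cpsiK : {in ccod, cancel cpsi cphi};
  cphi_cont : forall p, cdom p -> {for p, continuous cphi};
  cpsi_cont : forall x, ccod x -> {for x, continuous cpsi} }.

(* The atlas need not be maximal: it determines the smooth structure. *)
Record manifold (R : realType) (n : nat) := Manifold {
  carrier :> topologicalType;
  carrier_hausdorff : hausdorff_space carrier;
  carrier_second_countable : @second_countable carrier;
  atlas : set (chart R n carrier);
  atlas_cover : forall p : carrier, exists2 c, atlas c & cdom c p;
  atlas_compat : forall c d, atlas c -> atlas d -> forall j,
    Cinfty (ccod c `&` cpsi c @^-1` cdom d)
           (fun x => cphi d (cpsi c x) 0 j) }.

Section SmoothFunctions.
Context {R : realType} {n : nat} {M : manifold R n}.
Implicit Types (U : set M) (f g : M -> R).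

Definition smooth_on U f := forall c, atlas c ->
  Cinfty (ccod c `&` cpsi c @^-1` U) (f \o cpsi c).

Lemma chart_preim_open (c : chart R n M) U : open U ->
  open (ccod c `&` cpsi c @^-1` U).
Proof.
move=> oU; rewrite openE => x [cx Ux]; apply: filterI.
  by apply: open_nbhs_nbhs; split=> //; exact: ccod_open.
by apply: (cpsi_cont cx); apply: open_nbhs_nbhs.
Qed.

Lemma smooth_on_cover U f :
  (forall p, U p -> exists2 V, V p & smooth_on V f) -> smooth_on U f.
Proof.
move=> H c ac k; apply: Ck_cover => x [cx /H[V Vx Cf]].
by exists (ccod c `&` cpsi c @^-1` V) => //; exact: Cf.
Qed.

Lemma smooth_on_sub U V f : V `<=` U -> smooth_on U f -> smooth_on V f.
Proof. by move=> VU Cf; apply: smooth_on_cover => p /VU Up; exists U. Qed.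

Lemma smooth_on_cst U (a : R) : smooth_on U (fun=> a).
Proof. by move=> c ac k; exact: Ck_cst. Qed.

Lemma smooth_on_eq U f g : open U -> (forall p, U p -> f p = g p) ->
  smooth_on U f -> smooth_on U g.
Proof.
move=> oU fg Cf c ac k; apply: Ck_eq (Cf c ac k); first exact: chart_preim_open.
by move=> x /set_mem[_ /fg].
Qed.

Lemma smooth_onD U f g : open U -> smooth_on U f -> smooth_on U g ->
  smooth_on U (fun p => f p + g p).
Proof.
move=> oU Cf Cg c ac k; exact (CkD (chart_preim_open oU) (Cf _ ac k) (Cg _ ac k)).
Qed.

Lemma smooth_onM U f g : open U -> smooth_on U f -> smooth_on U g ->
  smooth_on U (fun p => f p * g p).
Proof.
move=> oU Cf Cg c ac k; exact (CkM (chart_preim_open oU) (Cf _ ac k) (Cg _ ac k)).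
Qed.

Lemma smooth_on_sum U (I : Type) (r : seq I) (F : I -> M -> R) : open U ->
  (forall i, smooth_on U (F i)) -> smooth_on U (fun p => \sum_(i <- r) F i p).
Proof.
move=> oU CF; elim: r => [|i r IH].
  by apply: smooth_on_eq (smooth_on_cst _ 0) => // p _; rewrite big_nil.
apply: smooth_on_eq (smooth_onD oU (CF i) IH) => // p _.
by rewrite big_cons.
Qed.

Definition smooth_pred : {pred (M -> R^o)} := fun f => `[< smooth_on setT f >].

Lemma smooth_predP f : reflect (smooth_on setT f) ((f : M -> R^o) \in smooth_pred).
Proof. exact: asboolP. Qed.

Lemma smooth_subring : subring_closed smooth_pred.
Proof.
have mul : {in smooth_pred &, forall f g, f * g \in smooth_pred}.
  move=> f g /smooth_predP Cf /smooth_predP Cg.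
  by apply/smooth_predP; exact (smooth_onM openT Cf Cg).
split=> //; first by apply/smooth_predP; exact: smooth_on_cst.
move=> f g /smooth_predP Cf /smooth_predP Cg; apply/smooth_predP.
apply: smooth_onD openT Cf _.
apply: smooth_on_eq openT _ (smooth_onM openT (@smooth_on_cst setT (-1)) Cg).
by move=> p _; rewrite mulN1r.
Qed.

Lemma smooth_scaler : GRing.scaler_closed smooth_pred.
Proof.
move=> a f /smooth_predP Cf.
by apply/smooth_predP; exact (smooth_onM openT (smooth_on_cst _ a) Cf).
Qed.

HB.instance Definition _ :=
  GRing.isSubringClosed.Build (M -> R^o) smooth_pred smooth_subring.
HB.instance Definition _ :=
  GRing.isScaleClosed.Build R (M -> R^o) smooth_pred smooth_scaler.

End SmoothFunctions.

Record Cinf (R : realType) (n : nat) (M : manifold R n) := MkCinf {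
  cinf_fun :> M -> R^o;
  cinf_smooth : cinf_fun \in @smooth_pred R n M }.

Section CinfInstances.
Context {R : realType} {n : nat} {M : manifold R n}.
HB.instance Definition _ := [isSub for @cinf_fun R n M].
HB.instance Definition _ := [Choice of Cinf M by <:].
HB.instance Definition _ := GRing.SubChoice_isSubComPzRing.Build _ _ (Cinf M)
  (GRing.subringClosedP _).
HB.instance Definition _ := [SubZmodule_isSubLmodule of Cinf M by <:].
End CinfInstances.

Definition Cinf_of R n (M : manifold R n) (f : M -> R)
  (Cf : smooth_on setT f) : Cinf M := MkCinf (introT (smooth_predP f) Cf).

Lemma Cinf_smooth R n (M : manifold R n) (f : Cinf M) : smooth_on setT f.
Proof. exact: elimT (smooth_predP f) (cinf_smooth f). Qed.

Section Tangent.
Context {R : realType} {n : nat} {M : manifold R n}.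

Definition derivation_at (p : M) : {pred (Cinf M -> R^o)} := fun v =>
  `[< scalar v /\ forall f g, v (f * g) = f p * v g + g p * v f >].

Lemma derivation_at_submod p : submod_closed (derivation_at p).
Proof.
split.
  have z f : (0 : Cinf M -> R^o) f = 0 by [].
  by apply/asboolP; split=> [a f g|f g]; rewrite !z !mulr0 addr0.
move=> a v w /asboolP[lv Lv] /asboolP[lw Lw]; apply/asboolP.
have e f : (a *: v + w) f = a * v f + w f by [].
by split=> [b f g|f g]; rewrite !e ?lv ?lw ?Lv ?Lw /=; ring.
Qed.

HB.instance Definition _ p := GRing.isSubmodClosed.Build R (Cinf M -> R^o)
  (derivation_at p) (derivation_at_submod p).

End Tangent.

(* Tangent vectors are the derivations at p of the algebra Cinf M. *)
Record tangent (R : realType) (n : nat) (M : manifold R n) (p : M) := Tangent {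
  tangent_fun :> Cinf M -> R^o;
  tangentP : tangent_fun \in derivation_at p }.

Section TangentInstances.
Context {R : realType} {n : nat} {M : manifold R n} {p : M}.
HB.instance Definition _ := [isSub for @tangent_fun R n M p].
HB.instance Definition _ := [Choice of @tangent R n M p by <:].
HB.instance Definition _ := [SubChoice_isSubLmodule of @tangent R n M p by <:].
End TangentInstances.

Lemma tangent_linear (R : realType) (n : nat) (M : manifold R n) (p : M)
  (v : tangent p) : scalar v.
Proof. by have /asboolP[] := tangentP v. Qed.

Lemma tangent_leibniz (R : realType) (n : nat) (M : manifold R n) (p : M)
  (v : tangent p) (f g : Cinf M) : v (f * g) = f p * v g + g p * v f.
Proof. by have /asboolP[] := tangentP v. Qed.

Record vfield (R : realType) (n : nat) (M : manifold R n) := VField {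
  vf_val :> forall p : M, tangent p;
  vf_smooth : forall f : Cinf M, smooth_on setT (fun p => vf_val p f) }.

Section VectorFields.
Context {R : realType} {n : nat} {M : manifold R n}.
Implicit Types (X Y : vfield M) (f g : Cinf M).

Definition vapp X f : Cinf M := Cinf_of (vf_smooth X f).

Lemma vapp_linear X (a : R) f g : vapp X (a *: f + g) = a *: vapp X f + vapp X g.
Proof. by apply/val_inj/funext => p; rewrite /= tangent_linear. Qed.

Lemma vapp_leibniz X f g : vapp X (f * g) = f * vapp X g + g * vapp X f.
Proof. by apply/val_inj/funext => p; rewrite /= tangent_leibniz. Qed.

Lemma bracket_derivation X Y p :
  ((fun f => X p (vapp Y f) - Y p (vapp X f)) : Cinf M -> R^o)
    \in derivation_at p.
Proof.
have tD (v : tangent p) f g : v (f + g) = v f + v g.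
  by rewrite -[f]scale1r tangent_linear mul1r scale1r.
apply/asboolP; split=> [a f g|f g].
  by rewrite !vapp_linear !tangent_linear /=; ring.
rewrite !vapp_leibniz !tD !tangent_leibniz /=; ring.
Qed.

Lemma bracket_smooth X Y f : smooth_on setT
  (fun p => Tangent (bracket_derivation X Y p) f).
Proof. exact (Cinf_smooth (vapp X (vapp Y f) - vapp Y (vapp X f))). Qed.

Definition bracket X Y : vfield M := VField (bracket_smooth X Y).

Lemma vcomb_smooth f X Y g :
  smooth_on setT (fun p => (f p *: X p + Y p : tangent p) g).
Proof. exact (Cinf_smooth (f * vapp X g + vapp Y g)). Qed.

Definition vcomb f X Y : vfield M := VField (vcomb_smooth f X Y).

End VectorFields.

(* A vector bundle is given by its fibres together with a family of local
   frames covering M whose transition functions are smooth; these frames are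
   the local trivialisations. *)
Record vbundle (R : realType) (n : nat) (M : manifold R n) (r : nat) := VBundle {
  fiber :> M -> vectType R;
  frame_index : Type;
  fdom : frame_index -> set M;
  fdom_open : forall a, open (fdom a);
  fdom_cover : forall p, exists a, fdom a p;
  frame : frame_index -> forall p, r.-tuple (fiber p);
  frame_basis : forall a p, fdom a p -> basis_of fullv (frame a p);
  frame_smooth : forall a b i j, smooth_on (fdom a `&` fdom b)
    (fun p => coord (frame b p) j (frame a p)`_i) }.

Section Bundles.
Context {R : realType} {n : nat} {M : manifold R n} {r : nat}.
Variable E : vbundle M r.

Definition smooth_section (s : forall p, E p) := forall (a : frame_index E) i,
  smooth_on (fdom a) (fun p => coord (frame a p) i (s p)).

Definition smooth_form (tau : forall p, E p -> E p -> R) :=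
  forall (a : frame_index E) (i j : 'I_r),
  smooth_on (fdom a) (fun p => tau p (frame a p)`_i (frame a p)`_j).

Definition smooth_endo (A : forall p, 'End(E p)) :=
  forall (a : frame_index E) (i j : 'I_r),
  smooth_on (fdom a) (fun p => coord (frame a p) j (A p (frame a p)`_i)).

(* The smooth sections of a subbundle W are those of E with values in W. *)
Record sections (W : forall p, {vspace E p}) := MkSection {
  sec_val :> forall p, E p;
  sec_in : forall p, sec_val p \in W p;
  sec_smooth : smooth_section sec_val }.

Lemma smooth_on_frames (f : M -> R) :
  (forall a : frame_index E, smooth_on (fdom a) f) -> smooth_on setT f.
Proof.
move=> H; apply: smooth_on_cover => p _.
by have [a ap] := fdom_cover E p; exists (fdom a).
Qed.

Lemma frame_decomp (a : frame_index E) p (u : E p) : fdom a p ->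
  u = \sum_i coord (frame a p) i u *: (frame a p)`_i.
Proof. by move=> ap; exact: coord_basis (frame_basis ap) (memvf u). Qed.

Lemma smooth_section_comb (f : Cinf M) (s t : forall p, E p) :
  smooth_section s -> smooth_section t ->
  smooth_section (fun p => f p *: s p + t p).
Proof.
move=> Ss St a i; have oa := fdom_open a.
have Cf : smooth_on (fdom a) f.
  exact: smooth_on_sub (Cinf_smooth f).
apply: smooth_on_eq (smooth_onD oa (smooth_onM oa Cf (Ss a i)) (St a i)) => //.
by move=> p _; rewrite linearD linearZ.
Qed.

Lemma smooth_section_endo (A : forall p, 'End(E p)) (s : forall p, E p) :
  smooth_endo A -> smooth_section s -> smooth_section (fun p => A p (s p)).
Proof.
move=> SA Ss a j; have oa := fdom_open a.
apply: smooth_on_eq (smooth_on_sum (index_enum _) oa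
  (fun i => smooth_onM oa (Ss a i) (SA a i j))) => // p ap.
rewrite [in RHS](frame_decomp (s p) ap) !linear_sum; apply: eq_bigr => i _.
by rewrite !linearZ.
Qed.

Lemma smooth_form_sections (tau : forall p, {biscalar E p})
    (s t : forall p, E p) :
  smooth_form tau -> smooth_section s -> smooth_section t ->
  smooth_on setT (fun p => tau p (s p) (t p)).
Proof.
move=> Stau Ss St; apply: smooth_on_frames => a; have oa := fdom_open a.
apply: smooth_on_eq (smooth_on_sum (index_enum _) oa (fun i =>
  smooth_on_sum (index_enum _) oa (fun j =>
  smooth_onM oa (smooth_onM oa (Ss a i) (St a j)) (Stau a i j)))) => // p ap.
rewrite [in RHS](frame_decomp (s p) ap) [in RHS](frame_decomp (t p) ap).
rewrite linear_sumlz; apply: eq_bigr => i _.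
rewrite linear_sumr; apply: eq_bigr => j _.
by rewrite (linearZl_LR (tau p)) (linearZr_LR (tau p)) /= mulrA.
Qed.

Variable W : forall p, {vspace E p}.

Lemma sec_comb_in (f : Cinf M) (s t : sections W) p : f p *: s p + t p \in W p.
Proof. by rewrite memvD ?memvZ ?sec_in. Qed.

Definition sec_comb (f : Cinf M) (s t : sections W) : sections W :=
  MkSection (sec_comb_in f s t)
    (smooth_section_comb f (@sec_smooth _ s) (@sec_smooth _ t)).

(* sec_comb and vcomb fold additivity and the scalar rule into one law *)
Record connection := Connection {
  nabla :> vfield M -> sections W -> sections W;
  nabla_linear : forall f X Y s p,
    nabla (vcomb f X Y) s p = f p *: nabla X s p + nabla Y s p;
  nabla_leibniz : forall X f s t p,
    nabla X (sec_comb f s t) p =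
    vapp X f p *: s p + f p *: nabla X s p + nabla X t p }.

(* Bundle maps TM -> E over the identity. A fibrewise linear map is smooth iff
   it maps smooth sections to smooth sections. *)
Record bundle_map := BundleMap {
  bmap :> forall p : M, {linear tangent p -> E p};
  bmap_smooth : forall X : vfield M, smooth_section (fun p => bmap p (X p)) }.

End Bundles.

Arguments MkSection {R n M r E W sec_val}.

Variant sign := Plus | Minus.
Definition opp_sign s := if s is Plus then Minus else Plus.
Definition sign_val (R : realType) s : R := if s is Plus then 1 else -1.

Lemma sign_valK (R : realType) s : sign_val R s * sign_val R s = 1.
Proof. by case: s => /=; ring. Qed.

Lemma sign_val_opp (R : realType) s :
  sign_val R s * sign_val R (opp_sign s) = -1.
Proof. by case: s => /=; ring. Qed.

Definition eigenbundle R n (M : manifold R n) r (E : vbundle M r)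
  (I : forall p, 'End(E p)) (s : sign) (p : M) : {vspace E p} :=
  passmx.leigenspace (I p) (sign_val R s).

Record para_hermitian (R : realType) (n : nat) (M : manifold R n)
    (E : vbundle M (2 * n)) := ParaHermitian {
  metric : forall p, {biscalar E p};
  metric_smooth : smooth_form metric;
  metric_sym : forall p u v, metric p u v = metric p v u;
  metric_nondeg : forall p u, (forall v, metric p u v = 0) -> u = 0;
  pcx : forall p, 'End(E p);
  pcx_smooth : smooth_endo pcx;
  pcx_sqr : forall p, (pcx p \o pcx p)%VF = \1%VF;
  pcx_neq_id : ~ (forall p, pcx p = \1%VF);
  eigen_rank : forall p,
    \dim (eigenbundle pcx Plus p) = \dim (eigenbundle pcx Minus p);
  eigen_sum : forall p,
    (eigenbundle pcx Plus p + eigenbundle pcx Minus p)%VS = fullv;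
  eigen_direct : forall p,
    directv (eigenbundle pcx Plus p + eigenbundle pcx Minus p);
  metric_pcx : forall p u v, metric p (pcx p u) v + metric p u (pcx p v) = 0 }.

Section ParaHermitian.
Context {R : realType} {n : nat} {M : manifold R n} {E : vbundle M (2 * n)}.
Variable H : para_hermitian E.
Local Notation I := (pcx H).
Local Notation tau := (metric H).
Local Notation Eb := (eigenbundle I).
Implicit Types (X Y Z : vfield M) (p : M) (s : sign).

Definition omega p (u v : E p) : R := tau p u (I p v).

Definition lagrangian p (U : {vspace E p}) :=
  \dim U = n /\ {in U &, forall u v, omega u v = 0}.

Definition proj s p : 'End(E p) := daddv_pi (Eb s p) (Eb (opp_sign s) p).

Definition pairing (W1 W2 : forall p, {vspace E p}) (s : sections W1)
  (t : sections W2) : Cinf M :=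
  Cinf_of (smooth_form_sections (metric_smooth H) (sec_smooth s) (sec_smooth t)).

Definition dual_connection (np : connection (Eb Plus))
    (nm : connection (Eb Minus)) :=
  forall X (s : sections (Eb Plus)) (t : sections (Eb Minus)) p,
    vapp X (pairing s t) p = tau p (np X s p) (t p) + tau p (s p) (nm X t p).

Lemma eigenP s p u : u \in Eb s p -> I p u = sign_val R s *: u.
Proof.
by rewrite memv_ker add_lfunE opp_lfunE scale_lfunE id_lfunE subr_eq0 => /eqP.
Qed.

Lemma projE s p u : proj s p u = 2^-1 *: (u + sign_val R s *: I p u).
Proof.
have dir : (Eb s p :&: Eb (opp_sign s) p = 0)%VS.
  by have /directv_addP := eigen_direct H p; case: s => //=; rewrite capvC.
have sum : (Eb s p + Eb (opp_sign s) p = fullv)%VS.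
  by clear dir; have := eigen_sum H p; case: s => //=; rewrite addvC.
have us : u \in (Eb s p + Eb (opp_sign s) p)%VS by rewrite sum memvf.
have Da := daddv_pi_add dir us.
have Ia := eigenP (memv_pi (Eb s p) (Eb (opp_sign s) p) u).
have Ib := eigenP (memv_pi (Eb (opp_sign s) p) (Eb s p) u).
rewrite -/(proj s p) in Da Ia; set b := daddv_pi _ _ u in Da Ib.
have -> : I p u = I p (proj s p u) + I p b by rewrite -linearD Da.
rewrite Ia Ib (scalerDr (sign_val R s)) 2!(scalerA (sign_val R s)) sign_valK.
rewrite sign_val_opp scale1r scaleN1r.
rewrite -[X in X + _]Da addrACA subrr addr0.
by rewrite -mulr2n -(scaler_nat 2 (proj s p u)) scalerA mulVf ?pnatr_eq0 ?scale1r.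
Qed.

Lemma proj_smooth s : smooth_endo (proj s).
Proof.
move=> a i j; have oa := fdom_open a.
have sI := smooth_onM oa (smooth_on_cst (fdom a) (sign_val R s))
  (@pcx_smooth _ _ _ _ H a i j).
apply: smooth_on_eq (smooth_onM oa (smooth_on_cst (fdom a) 2^-1)
  (smooth_onD oa (smooth_on_cst (fdom a) (i == j)%:R) sI)) => // p ap.
have fr := basis_free (frame_basis ap).
by rewrite projE linearZ linearD linearZ /= coord_free.
Qed.

Variable Phi : bundle_map E.

(* \dim U = n, stated twice, is the rank condition on Phi p. The witness U is
   needed because tangent p is not declared finite dimensional. *)
Definition lagrangian_image := forall p, exists U : {vspace E p},
  [/\ forall u, u \in U <-> exists v, u = Phi p v, \dim U = n & lagrangian U].

Definition Phi_ s p (v : tangent p) : E p := proj s p (Phi p v).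

Lemma Phi_in s X p : Phi_ s (X p) \in Eb s p.
Proof. exact: memv_pi. Qed.

Lemma Phi_smooth s X : smooth_section (fun p => Phi_ s (X p)).
Proof. exact: smooth_section_endo (proj_smooth s) (bmap_smooth Phi X). Qed.

Definition Phi_sec s X : sections (Eb s) :=
  MkSection (Phi_in s X) (Phi_smooth s X).

Local Notation "Phi+" := (Phi_sec Plus).
Local Notation "Phi-" := (Phi_sec Minus).

(* set_bij suffices: Phi_ s is fibrewise linear and smooth, so a fibrewise
   bijection is a bundle isomorphism TM -> E^s. *)
Definition Phi_iso s :=
  forall p, set_bij [set: tangent p] [set u | u \in Eb s p] (@Phi_ s p).

Definition torsion s (nb : connection (Eb s)) X Y p : E p :=
  nb X (Phi_sec s Y) p - nb Y (Phi_sec s X) p - Phi_sec s (bracket X Y) p.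

Definition torsion_free s (nb : connection (Eb s)) :=
  forall X Y p, torsion nb X Y p = 0.

Definition h_tensor p (v w : tangent p) : R := tau p (Phi p v) (Phi p w).

Definition h_nondegenerate :=
  forall p v, (forall w, @h_tensor p v w = 0) -> v = 0.

Variables (np : connection (Eb Plus)) (nm : connection (Eb Minus)).

Definition C_tensor X Y Z p : R :=
  - 2 * (tau p (np X (Phi+ Y) p) (Phi- Z p) - tau p (Phi+ Z p) (nm X (Phi- Y) p)).

Definition C_symmetric := forall X Y Z p, C_tensor X Y Z p = C_tensor Y X Z p.

Definition kossowski X Y Z p : R :=
  vapp X (pairing (Phi+ Y) (Phi- Z)) p
  + vapp Y (pairing (Phi+ Z) (Phi- X)) p
  - vapp Z (pairing (Phi+ X) (Phi- Y)) p
  - tau p (Phi+ X p) (Phi- (bracket Y Z) p)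
  + tau p (Phi+ Y p) (Phi- (bracket Z X) p)
  + tau p (Phi+ Z p) (Phi- (bracket X Y) p).

Definition kossowski_formula := forall X Y Z p,
  kossowski X Y Z p =
  tau p (np X (Phi+ Y) p) (Phi- Z p) + tau p (Phi+ Z p) (nm X (Phi- Y) p).

End ParaHermitian.

(* Main.v *)
Require Import Defs.
From mathcomp Require Import all_boot all_order all_algebra.
From mathcomp Require Import all_classical all_reals all_analysis.
From mathcomp Require Import ring lra zify.
Set Implicit Arguments.
Unset Strict Implicit.
Unset Printing Implicit Defensive.
Import Order.TTheory GRing.Theory Num.Theory.
Import numFieldNormedType.Exports.
Local Open Scope classical_set_scope.
Local Open Scope ring_scope.

(* Write T+(X,Y,Z) = tau(T^{nabla+}(X,Y), Phi-(Z)) and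
   T-(X,Y,Z) = tau(Phi+(Z), T^{nabla-}(X,Y)).  The Lagrangian condition says
   that tau(Phi+(X), Phi-(Y)) is symmetric in X and Y; with the duality of the
   connections this turns (iii) into T+ = T- and (iv) into
   T+(Y,Z,X) = T-(X,Y,Z) + T-(Z,X,Y), so that each part becomes linear algebra
   on T+ and T-.  Going back from T- = 0 to a vanishing torsion requires every
   vector of E+ at p to be Phi+(Z(p)) for a vector field Z, when Phi+ is
   injective.  Cutting the coordinate fields of a chart off by a bump function
   gives n global fields, independent at p; their images under Phi+ are n
   independent vectors of the n-dimensional fibre of E+, hence a basis. *)

(** * A function on the line that is flat at 0 and positive to its right *)

Section FlatExp.
Context {R : realType}.

(** The power [m] closes the family under differentiation, up to linear combinations; the cutoff
    itself uses [m = 0]. *)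
Definition flat_exp (m : nat) (x : R) : R :=
  if 0 < x then x^-1 ^+ m * expR (- x^-1) else 0.

Lemma flat_exp_gt0 m x : 0 < x -> 0 < flat_exp m x.
Proof.
by move=> x0; rewrite /flat_exp x0 mulr_gt0 ?expR_gt0 ?exprn_gt0 ?invr_gt0.
Qed.

Lemma flat_exp_le0 m x : x <= 0 -> flat_exp m x = 0.
Proof. by rewrite /flat_exp leNgt => /negbTE ->. Qed.

(* The quadratic bound makes every [flat_exp m] differentiable at 0, with zero
   derivative; it comes from [t ^+ m.+2 / m.+2`! <= expR t] at [t = x^-1]. *)
Lemma flat_exp_sqr m x : `|flat_exp m x| <= m.+2`!%:R * x ^+ 2.
Proof.
have [x0|x0] := ltP 0 x; last first.
  by rewrite flat_exp_le0 // normr0 mulr_ge0 ?sqr_ge0.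
rewrite ger0_norm ?(ltW (flat_exp_gt0 _ x0)) // /flat_exp x0 expRN.
have t0 : 0 < x^-1 by rewrite invr_gt0.
have f0 : (0 : R) < m.+2`!%:R by rewrite ltr0n fact_gt0.
have : x^-1 ^+ m.+2 / m.+2`!%:R <= expR x^-1.
  by apply: le_trans (expR_ge1Dxn m.+1 (ltW t0)); rewrite lerDr.
rewrite ler_pdivrMr // mulrC => H.
rewrite ler_pdivrMr ?expR_gt0 // -mulrA mulrCA.
have -> : x^-1 ^+ m = x ^+ 2 * x^-1 ^+ m.+2.
  rewrite -[m.+2]addn2 [in RHS](exprD _ m) mulrCA -exprMn.
  by rewrite divff ?lt0r_neq0 // expr1n mulr1.
by rewrite ler_pM2l ?exprn_gt0.
Qed.

Lemma is_derive_flat_exp m (x : R) :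
  is_derive x 1 (flat_exp m) (flat_exp m.+2 x - m%:R * flat_exp m.+1 x).
Proof.
have [x0|x0|->] := ltgtP x 0.
- rewrite !flat_exp_le0 ?ltW // mulr0 subr0.
  apply: (@near_eq_is_derive _ _ _ (cst 0)) => //.
    by near=> y; rewrite /= flat_exp_le0 // ltW //; near: y; exact: lt_nbhsl.
- apply: (@near_eq_is_derive _ _ _ ((fun y : R => y^-1) ^+ m *
    (expR \o (fun y : R => - y^-1)))).
    by near=> y; rewrite /flat_exp ifT ?fctE //; near: y; exact: lt_nbhsr.
  have xn : x != 0 by rewrite gt_eqF.
  have dV : is_derive x 1 (fun y : R => y^-1) (- x^-1 ^+ 2).
    apply: is_derive_eq (is_deriveV xn (is_derive_id x 1)) _.
    by rewrite exprVn [LHS]mulr1.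
  apply: is_derive_eq (is_deriveM (is_deriveX m dV)
    (is_derive1_comp (is_derive_expR _) (is_deriveN dV))) _.
  rewrite /flat_exp x0 /GRing.scale /= exprfctE.
  case: m => [|m]; first by rewrite !expr0 /=; ring.
  by rewrite /= !exprS; ring.
rewrite !flat_exp_le0 // mulr0 subr0.
(* By [flat_exp_sqr], the difference quotient at 0 is at most a constant times [|h|]. *)
have cv : h^-1 *: (flat_exp m (h *: 1 + 0) - flat_exp m 0) @[h --> 0^'] --> 0.
  apply/cvgr0Pnorm_le => /= e e0; near=> h.
  rewrite addr0 [h *: 1]mulr1 (@flat_exp_le0 m 0) // subr0 normrZ normfV.
  have h0 : h != 0 by near: h; exact: nbhs_dnbhs_neq.
  rewrite ler_pdivrMl ?normr_gt0 //; apply: le_trans (flat_exp_sqr m h) _.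
  rewrite -real_normK ?num_real // expr2 mulrCA ler_wpM2l //.
  rewrite mulrC -ler_pdivlMr ?ltr0n ?fact_gt0 // ltW //.
  by near: h; apply: dnbhs0_lt; rewrite divr_gt0 ?ltr0n ?fact_gt0.
by apply: DeriveDef; [apply/cvg_ex; exists 0|exact: cvg_lim].
Unshelve. all: by end_near.
Qed.

End FlatExp.

(** * Chain rule and partial derivatives *)

Section Calculus.
Context {R : realType}.

Lemma derive_comp_diff (U V W : normedModType R) (f : V -> W) (g : U -> V) x v :
  differentiable g x -> differentiable f (g x) ->
  'D_v (f \o g) x = 'D_('D_v g x) f (g x).
Proof.
move=> dg df; rewrite deriveE; last exact: differentiable_comp.
by rewrite diff_comp //= [in RHS]deriveE // deriveE.
Qed.

Lemma derive_sum_partial n (f : 'rV[R]_n -> R) x v : differentiable f x ->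
  'D_v f x = \sum_j v 0 j * 'D_(delta_mx 0 j) f x.
Proof.
move=> df; rewrite deriveE // [in LHS](row_sum_delta v) linear_sum /=.
by apply: eq_bigr => j _; rewrite linearZ deriveE.
Qed.

Lemma derive_dir1 (f : R -> R) x v :
  differentiable f x -> 'D_v f x = v * 'D_1 f x.
Proof.
by move=> df; rewrite !deriveE // -[X in 'd f x X]mulr1 linearZ.
Qed.

Lemma differentiable_rV m n (g : 'rV[R]_m -> 'rV[R]_n) x :
  (forall j, differentiable (fun y => g y 0 j) x) -> differentiable g x.
Proof.
move=> dg.
have -> : g = \sum_j (fun y => g y 0 j *: (delta_mx 0 j : 'rV[R]_n)).
  by apply/funext => y; rewrite fct_sumE -row_sum_delta.
by apply: differentiable_sum => j; exact: differentiableZl.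
Qed.

End Calculus.

(** * Closure of C^k functions under sums and composition *)

Section CkTheory.
Context {R : realType} {m n : nat}.
Implicit Types (U : set 'rV[R]_n) (V : set 'rV[R]_m).

Lemma Ck_sum k U (I : Type) (r : seq I) (F : I -> 'rV[R]_n -> R) : open U ->
  (forall i, Ck k U (F i)) -> Ck k U (fun x => \sum_(i <- r) F i x).
Proof.
move=> oU CF; elim: r => [|i r IH].
  by apply: Ck_eq oU _ (Ck_cst k U 0) => // p _; rewrite big_nil.
by apply: Ck_eq oU _ (CkD oU (CF i) IH) => // p _; rewrite big_cons.
Qed.

(** By the chain rule, a partial derivative of [f \o g] is a sum of products of partials of [g] with
    partials of [f] composed with [g]; the induction on [k] applies to each factor. *)
Lemma Ck_comp k U V f (g : 'rV[R]_n -> 'rV[R]_m) : open U ->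
  (forall x, U x -> V (g x)) -> (forall j, Cinfty U (fun x => g x 0 j)) ->
  Ck k V f -> Ck k U (f \o g).
Proof.
move=> oU UV Cg; elim: k f => [|k IH] f.
all: have dg x : U x -> differentiable g x
  by move=> Ux; apply: differentiable_rV => j; have [+ _] := Cg j 1; apply.
  move=> Cf x Ux; apply: continuous_comp; last by apply: Cf; exact: UV.
  by apply: differentiable_continuous; exact: dg.
move=> [df Df]; split=> [x Ux|i].
  by apply: differentiable_comp; [exact: dg|apply: df; exact: UV].
apply: Ck_eq oU _ (Ck_sum (index_enum _) oU (fun j =>
  CkM oU ((Cg j k.+1).2 i) (IH _ (Df j)))) => x /set_mem Ux.
rewrite derive_comp_diff; [|exact: dg|by apply: df; exact: UV].
rewrite derive_sum_partial; last by apply: df; exact: UV.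
apply: eq_bigr => j _; congr (_ * _).
by rewrite derive_mx ?mxE //; apply: diff_derivable; exact: dg.
Qed.

(** The induction runs over all [l] at once, since differentiating brings in [l.+1] and [l.+2]. *)
Lemma Ck_flat_exp k U l f : open U -> Ck k U f -> Ck k U (flat_exp l \o f).
Proof.
move=> oU; elim: k l f => [|k IH] l f.
  move=> Cf x Ux; apply: continuous_comp; first exact: Cf.
  apply: differentiable_continuous; apply/derivable1_diffP.
  by have [] := is_derive_flat_exp l (f x).
move=> Cf; have [df Df] := Cf.
have dF (y : R) : differentiable (flat_exp l) y.
  by apply/derivable1_diffP; have [] := is_derive_flat_exp l y.
split=> [x Ux|i]; first by apply: differentiable_comp; [exact: df|].
have Cf' := CkS Cf.
apply: Ck_eq oU _ (CkM oU (Df i) (CkD oU (IH l.+2 _ Cf')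
  (CkM oU (Ck_cst k U (- l%:R)) (IH l.+1 _ Cf')))) => x /set_mem Ux.
rewrite [RHS]derive_comp_diff; [|exact: df|exact: dF].
rewrite derive_dir1 //.
have [_ ->] := is_derive_flat_exp l (f x).
by rewrite mulNr.
Qed.
End CkTheory.

Lemma derive_coord (R : realType) n (x v : 'rV[R]_n) j :
  'D_v (fun y : 'rV[R]_n => y 0 j) x = v 0 j.
Proof.
have := @derive_mx R 'rV[R]_n 1 n id x v (@derivable_id _ _ x v).
by rewrite derive_id => /matrixP/(_ 0 j); rewrite mxE => <-.
Qed.

(** Serves to remove the derivative of the cutoff when the coordinate fields are evaluated. *)
Lemma deriveM_vanish (R : realType) (V : normedModType R) (f g : V -> R) x v :
  derivable f x v -> derivable g x v -> g x = 0 ->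
  'D_v (f * g) x = f x * 'D_v g x.
Proof.
move=> df dg g0.
by rewrite (deriveM df dg) g0 scale0r addr0.
Qed.

Lemma Cinfty_coord (R : realType) n (U : set 'rV[R]_n) j :
  Cinfty U (fun y : 'rV[R]_n => y 0 j).
Proof.
case=> [|k] /=; first by move=> x _; exact: coord_continuous.
split=> [x _|i]; first exact: differentiable_coord.
have -> : (fun x : 'rV[R]_n => 'D_(delta_mx 0 i) (fun y : 'rV[R]_n => y 0 j) x)
    = fun=> (delta_mx 0 i : 'rV[R]_n) 0 j.
  by apply/funext => x; rewrite derive_coord.
exact: Ck_cst.
Qed.

(** * Bump functions supported in a chart *)

Section Cutoff.
Context {R : realType} {n : nat} {M : manifold R n}.
Variables (c : chart R n M) (ac : atlas c).

(** Read in another chart of the atlas, the function is [G] after a transition map. *)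
Lemma smooth_on_chart G : Cinfty (ccod c) G -> smooth_on (cdom c) (G \o cphi c).
Proof.
move=> CG d ad k.
apply: (Ck_comp (g := fun x => cphi c (cpsi d x)) _ _ _ (CG k)).
- exact/chart_preim_open/cdom_open.
- by move=> x [_ /cphi_cod].
- exact: atlas_compat.
Qed.

(** A bump in the chart, extended by 0. The extension is smooth because [rho] vanishes off the image
    of a compact cube, and that image is closed since [M] is Hausdorff. *)
Lemma smooth_cutoff (p : M) : cdom c p -> exists rho : M -> R,
  [/\ rho p != 0, forall q, ~ cdom c q -> rho q = 0 &
   forall g, Cinfty (ccod c) g ->
     smooth_on setT (fun q => rho q * g (cphi c q))].
Proof.
move=> cp; set x0 := cphi c p.
have /nbhs_ballP[e /= e0 eU] : nbhs x0 (ccod c).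
  by apply: open_nbhs_nbhs; split; [exact: ccod_open|exact: cphi_cod].
(* The norm is the sup norm, so halving the radius keeps the closed cube [B] inside the ball of
   radius [e]. *)
pose r := e / 2; have r0 : 0 < r by rewrite divr_gt0.
pose B := [set x : 'rV[R]_n | forall i, x 0 i \in `[x0 0 i - r, x0 0 i + r]].
have cB : compact B.
  apply: (rV_compact (A := fun i => [set` `[x0 0 i - r, x0 0 i + r]])) => i.
  exact: segment_compact.
have BU : B `<=` ccod c.
  move=> x Bx; apply: eU; split=> // i j; rewrite ord1.
  have := Bx j; rewrite /= in_itv /= /ball /= => /andP[a b].
  rewrite ltr_norml; apply/andP; split; rewrite /r in a b r0 *; lra.
have KM : closed (cpsi c @` B).
  apply: compact_closed; first exact: carrier_hausdorff.
  apply: continuous_compact cB; apply: continuous_in_subspaceT => x /set_mem Bx.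
  by apply: cpsi_cont; exact: BU.
(* [r ^+ 2] minus the squared Euclidean distance to [x0]: positive at [x0], and at most 0 outside
   [B], which contains the Euclidean ball of radius [r]. *)
pose Q (x : 'rV[R]_n) : R :=
  r ^+ 2 + \sum_i - ((x 0 i - x0 0 i) * (x 0 i - x0 0 i)).
have CQ : Cinfty (ccod c) Q.
  have oc := @ccod_open _ _ _ c.
  move=> k; apply: CkD => //; first exact: Ck_cst.
  apply: Ck_sum => // i; have Ci := CkD oc (@Cinfty_coord R n _ i k)
    (Ck_cst k (ccod c) (- x0 0 i)).
  apply: Ck_eq oc _ (CkM oc (Ck_cst k _ (-1)) (CkM oc Ci Ci)) => x _.
  by rewrite mulN1r.
have QB x : ~ B x -> Q x <= 0.
  move=> Bx; rewrite leNgt; apply/negP => Q0; apply: Bx => i.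
  move: Q0; rewrite /Q (bigD1 i) //= => Q0.
  have : \sum_(j < n | j != i) - ((x 0 j - x0 0 j) * (x 0 j - x0 0 j)) <= 0.
    by apply: sumr_le0 => j _; rewrite oppr_le0 -expr2 sqr_ge0.
  move=> S0.
  have /ltW : `|x 0 i - x0 0 i| < r.
    rewrite -(@ltr_pXn2r _ 2) ?nnegrE ?normr_ge0 ?(ltW r0) //.
    by rewrite real_normK ?num_real // expr2; lra.
  rewrite in_itv /= ler_norml => /andP[? ?]; apply/andP; split; lra.
pose rho q := if `[< cdom c q >] then flat_exp 0 (Q (cphi c q)) else 0.
exists rho; split.
- rewrite /rho asboolT // gt_eqF //; apply: flat_exp_gt0.
  rewrite /Q big1 ?addr0 ?exprn_gt0 // => i _.
  by rewrite -/x0 subrr mulr0 oppr0.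
- by move=> q nq; rewrite /rho asboolF.
move=> g Cg; apply: smooth_on_cover => q _.
have [cq|nq] := pselect (cdom c q).
  exists (cdom c) => //.
  have oc := @ccod_open _ _ _ c.
  apply: (smooth_on_eq (@cdom_open _ _ _ c) _ (smooth_on_chart (fun k =>
    CkM oc (Ck_flat_exp 0 oc (CQ k)) (Cg k)))) => q' cq'.
  by rewrite /rho asboolT.
have Kq : (~` (cpsi c @` B)) q.
  by move=> [x /BU cx] E; apply: nq; rewrite -E; exact: cpsi_dom.
exists (~` (cpsi c @` B)) => //.
apply: (smooth_on_eq (closed_openC KM) _ (smooth_on_cst _ 0)) => q' Kq'.
rewrite /rho; case: asboolP => [cq'|_]; last by rewrite mul0r.
rewrite flat_exp_le0 ?mul0r //; apply: QB => Bq'; apply: Kq'.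
by exists (cphi c q') => //; rewrite cphiK //; exact: mem_set.
Qed.

End Cutoff.

(** * Global vector fields independent at a given point *)

Section Fields.
Context {R : realType} {n : nat} {M : manifold R n}.

Definition vzero_smooth (f : Cinf M) :
  smooth_on setT (fun p => (0 : tangent p) f) := smooth_on_cst setT 0.
Definition vzero : vfield M := VField vzero_smooth.

Lemma vfield_comb (p : M) k (a : 'I_k -> R) (X : 'I_k -> vfield M) :
  exists Z : vfield M, Z p = \sum_i a i *: X i p.
Proof.
elim/big_rec: _ => [|i v _ [Z Zp]]; first by exists vzero.
by exists (vcomb (Cinf_of (smooth_on_cst setT (a i))) (X i) Z); rewrite -Zp.
Qed.

Lemma tangent_sum (p : M) k (a : 'I_k -> R) (v : 'I_k -> tangent p) f :
  (\sum_i a i *: v i) f = \sum_i a i * v i f.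
Proof. by elim/big_rec2: _ => // i y1 y2 _ <-. Qed.

(** Tangent vectors act on global functions, so the coordinates are cut off as well as the partial
    derivatives. Each contributes a factor [rho p], whence the scalar [l]. *)
Lemma coordinate_fields (p : M) :
  exists (X : 'I_n -> vfield M) (y : 'I_n -> Cinf M) (l : R), l != 0 /\
  forall i j, X i p (y j) = l * (i == j)%:R.
Proof.
have [c ac cp] := atlas_cover p.
have [rho [rp r0 Cr]] := smooth_cutoff ac cp.
have oc := @ccod_open _ _ _ c.
have Cf (f : Cinf M) : Cinfty (ccod c) (f \o cpsi c).
  by move=> k; apply: Ck_sub (Cinf_smooth f ac k).
have DX i q : ((fun f => rho q * 'D_(delta_mx 0 i) (f \o cpsi c) (cphi c q))
    : Cinf M -> R^o) \in derivation_at q.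
  apply/asboolP; have [cq|nq] := pselect (cdom c q); last first.
    by split=> [a f g|f g]; rewrite r0 // !mul0r ?mulr0 ?addr0.
  have df (f : Cinf M) : derivable (f \o cpsi c) (cphi c q) (delta_mx 0 i).
    apply: diff_derivable; have [+ _] := Cf f 1; apply; exact: cphi_cod.
  have fq (f : Cinf M) : (f \o cpsi c) (cphi c q) = f q.
    by rewrite /= cphiK //; exact: mem_set.
  split=> [a f g|f g].
    rewrite -[_ \o _]/((a *: ((f : M -> R) \o cpsi c))
      + ((g : M -> R) \o cpsi c)).
    rewrite deriveD ?deriveZ //; last exact: derivableZ.
    by rewrite mulrDr mulrCA.
  rewrite -[_ \o _]/(((f : M -> R) \o cpsi c) * ((g : M -> R) \o cpsi c)).
  by rewrite deriveM // !fq mulrDr !(mulrCA (rho q)).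
have SX i f : smooth_on setT (fun q => Tangent (DX i q) f).
  exact: Cr _ (fun k => (Cf f k.+1).2 i).
(* Centring the coordinates at [p] makes them vanish there, as [deriveM_vanish] requires. *)
have Cy j : Cinfty (ccod c) (fun x => x 0 j + - cphi c p 0 j).
  by move=> k; apply: CkD => //; [exact: Cinfty_coord|exact: Ck_cst].
exists (fun i => VField (SX i)), (fun j => Cinf_of (Cr _ (Cy j))),
  (rho p * rho p).
split=> [|i j]; first by rewrite mulf_neq0.
(* The factor 1 exhibits [rho] itself as a smooth function, hence differentiable in the chart. *)
have C1 : Cinfty (ccod c) (fun=> 1) by move=> k; exact: Ck_cst.
have /= C_rho := Cf (Cinf_of (Cr _ C1)).
have xp := cphi_cod cp.
rewrite /=; set x := cphi c p in xp *.
pose g : 'rV[R]_n -> R := (fun z => z 0 j) - cst (x 0 j).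
have d1 : derivable (fun z : 'rV[R]_n => z 0 j) x (delta_mx 0 i).
  exact/diff_derivable/differentiable_coord.
have d2 : derivable (cst (x 0 j) : 'rV[R]_n -> R) x (delta_mx 0 i).
  exact: derivable_cst.
have dg : derivable g x (delta_mx 0 i) by exact: derivableB d1 d2.
have Dg : 'D_(delta_mx 0 i) g x = (i == j)%:R.
  rewrite (deriveB d1 d2) derive_coord derive_cst.
  by rewrite subr0 mxE eqxx eq_sym.
have dr : derivable (rho \o cpsi c) x (delta_mx 0 i).
  have -> : rho \o cpsi c = (fun q => rho q * 1) \o cpsi c.
    by apply/funext => z /=; rewrite mulr1.
  exact: diff_derivable ((C_rho 1).1 _ xp).
(* [cphi c (cpsi c z) = z] is available only on [ccod c], so the two functions are compared near
   [x]. *)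
rewrite (@near_eq_derive _ _ _ _ ((rho \o cpsi c) * g)).
  rewrite deriveM_vanish ?Dg // //; last exact: subrr.
  by rewrite /= cphiK ?mulrA //; exact: mem_set.
have : \forall z \near x, ccod c z by exact: open_nbhs_nbhs.
apply: filterS => z cz; rewrite /= !fctE /= cpsiK //; exact: mem_set.
Qed.

End Fields.

(** * The metric in terms of the splitting into eigenbundles *)

Section ParaHermitianAlgebra.
Context {R : realType} {n : nat} {M : manifold R n} {E : vbundle M (2 * n)}.
Variable H : para_hermitian E.
Local Notation I := (pcx H).
Local Notation tau := (metric H).
Local Notation Eb := (eigenbundle I).

Local Notation pr := (@Defs.proj _ _ _ _ H).

Lemma metricDl p (u v w : E p) : tau p (u + v) w = tau p u w + tau p v w :> R.
Proof. exact: linearDl. Qed.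

Lemma metricDr p (u v w : E p) : tau p u (v + w) = tau p u v + tau p u w :> R.
Proof. exact: linearDr. Qed.

Lemma metricBl p (u v w : E p) : tau p (u - v) w = tau p u w - tau p v w :> R.
Proof. exact: linearBl. Qed.

Lemma metricBr p (u v w : E p) : tau p u (v - w) = tau p u v - tau p u w :> R.
Proof. exact: linearBr. Qed.

Lemma metricNr p (u v : E p) : tau p u (- v) = - tau p u v :> R.
Proof. exact: linearNr. Qed.

Lemma metric0l p (u : E p) : tau p 0 u = 0 :> R.
Proof. exact: linear0l. Qed.

Lemma metric0r p (u : E p) : tau p u 0 = 0 :> R.
Proof. exact: linear0r. Qed.

(** Two summands of equal dimension split a fibre of dimension [2 * n]. *)
Lemma dim_eigenbundle s p : \dim (Eb s p) = n.
Proof.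
have /directv_addP dir := eigen_direct H p.
have := dimv_disjoint_sum dir; rewrite eigen_sum.
have [a ap] := fdom_cover E p.
have /andP[/eqP span fr] := frame_basis ap.
have -> : \dim (fullv : {vspace E p}) = (2 * n)%N.
  by rewrite -span (eqP fr) size_tuple.
have := eigen_rank H p.
by case: s; lia.
Qed.

(** [I] is skew for [tau] and acts on both vectors by the same sign, so twice the pairing is 0. *)
Lemma eigen_isotropic s p u v :
  u \in Eb s p -> v \in Eb s p -> tau p u v = 0 :> R.
Proof.
move=> /eigenP Iu /eigenP Iv; have := @metric_pcx _ _ _ _ H p u v.
rewrite Iu Iv (linearZl_LR (tau p)) (linearZr_LR (tau p)) /=.
by case: s {Iu Iv} => /=; lra.
Qed.

Lemma proj_sum p u : pr Plus p u + pr Minus p u = u.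
Proof.
rewrite !projE /= scale1r scaleN1r -scalerDr addrACA subrr addr0.
by rewrite -mulr2n -(scaler_nat 2 u) scalerA mulVf ?pnatr_eq0 ?scale1r.
Qed.

Lemma pcx_proj p u : I p u = pr Plus p u - pr Minus p u.
Proof.
rewrite -{1}(proj_sum u) linearD /=.
rewrite (@eigenP _ _ _ _ H Plus p (pr Plus p u)) ?memv_pi //.
rewrite (@eigenP _ _ _ _ H Minus p (pr Minus p u)) ?memv_pi //.
by rewrite scale1r scaleN1r.
Qed.

(** Each eigenbundle is isotropic, so only the component of a test vector in the opposite one can
    pair with [u]. *)
Lemma eigen_nondegenerate s p u : u \in Eb s p ->
  (forall w, w \in Eb (opp_sign s) p -> tau p u w = 0) -> u = 0.
Proof.
move=> us uw; apply: (metric_nondeg (p := p) (p0 := H)) => v.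
rewrite -(proj_sum v) metricDr.
case: s us uw => us uw.
  rewrite (uw (pr Minus p v)) ?memv_pi // addr0.
  by rewrite (eigen_isotropic us) ?memv_pi.
rewrite (uw (pr Plus p v)) ?memv_pi // add0r.
by rewrite (eigen_isotropic us) ?memv_pi.
Qed.

Lemma metric_proj_same s p u v : tau p (pr s p u) (pr s p v) = 0 :> R.
Proof. by apply: (@eigen_isotropic s); exact: memv_pi. Qed.

(** The expansion shared by [metric_proj] and [omega_proj], with [a], [c] in one eigenbundle and
    [b], [d] in the other. *)
Lemma metric_cross p (a b c d : E p) :
  tau p a c = 0 -> tau p b d = 0 ->
  tau p (a + b) (c + d) = tau p a d + tau p c b :> R.
Proof.
move=> ac bd; rewrite metricDl !metricDr ac bd add0r addr0.
by rewrite (Defs.metric_sym H b).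
Qed.

Lemma metric_proj p u v : tau p u v =
  tau p (pr Plus p u) (pr Minus p v) + tau p (pr Plus p v) (pr Minus p u) :> R.
Proof.
rewrite -(metric_cross (metric_proj_same _ _ _) (metric_proj_same _ _ _)).
by rewrite !proj_sum.
Qed.

Lemma omega_proj p u v : omega H u v =
  tau p (pr Plus p v) (pr Minus p u) - tau p (pr Plus p u) (pr Minus p v) :> R.
Proof.
have mm : tau p (pr Minus p u) (- pr Minus p v) = 0.
  by rewrite metricNr (metric_proj_same Minus u v) oppr0.
rewrite /omega pcx_proj -{1}(proj_sum u).
by rewrite (metric_cross (metric_proj_same Plus u v) mm) metricNr addrC.
Qed.

(** * Consequences of the Lagrangian condition *)

Variable Phi : bundle_map E.
Hypothesis Phi_lagrangian : lagrangian_image H Phi.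
Local Notation Ps := (Phi_ H Phi).

(** Up to sign, the difference of the two sides is [omega] on the images of [v] and [w]. *)
Lemma Phi_sym p (v w : tangent p) :
  tau p (Ps Plus v) (Ps Minus w) = tau p (Ps Plus w) (Ps Minus v) :> R.
Proof.
have [U [imU _ [_ lagU]]] := Phi_lagrangian p.
have inU w' : Phi p w' \in U by apply/imU; exists w'.
have := lagU _ _ (inU v) (inU w).
by rewrite omega_proj => /eqP; rewrite subr_eq0 => /eqP.
Qed.

Lemma h_tensorE p (v w : tangent p) :
  h_tensor H Phi v w = 2 * tau p (Ps Plus v) (Ps Minus w).
Proof.
by rewrite /h_tensor metric_proj -!/(Ps _ _) (Phi_sym w v) mulr_natl mulr2n.
Qed.

(** The common consequence of the isomorphism hypotheses and of the non-degeneracy of [h], from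
    which surjectivity is derived. *)
Definition Phi_injective s := forall p (v : tangent p), Ps s v = 0 -> v = 0.

Lemma Phi_iso_injective s : Phi_iso H Phi s -> Phi_injective s.
Proof.
move=> iso p v v0; have [_ inj _] := iso p; apply: inj; rewrite ?in_setT //.
by rewrite v0 /Phi_ !linear0.
Qed.

(** By symmetry, [Phi_ s v] can be placed in either slot of the pairing that gives [h], so one
    argument serves both signs. *)
Lemma h_nondegenerate_injective s : h_nondegenerate H Phi -> Phi_injective s.
Proof.
move=> nd p v v0; apply: nd => w; rewrite h_tensorE.
case: s v0 => v0; last rewrite Phi_sym.
  by rewrite v0 metric0l mulr0.
by rewrite v0 metric0r mulr0.
Qed.

(* Injectivity bounds the dimension of the tangent space by [n], so it need not
   be known in advance that the coordinate derivations span it. *)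
Lemma Phi_fields_surjective s p u : Phi_injective s -> u \in Eb s p ->
  exists Z : vfield M, Ps s (Z p) = u.
Proof.
move=> inj us.
have [X [y [l [l0 Xy]]]] := coordinate_fields p.
have Psum (a : 'I_n -> R) :
    Ps s (\sum_i a i *: X i p) = \sum_i a i *: Ps s (X i p).
  by rewrite /Phi_ !linear_sum; apply: eq_bigr => i _; rewrite !linearZ.
pose b := [tuple Ps s (X i p) | i < n].
have bE (i : 'I_n) : b`_i = Ps s (X i p) by rewrite -tnth_nth tnth_mktuple.
have fb : free b.
  apply/freeP => a; under eq_bigr do rewrite bE.
  rewrite -Psum => /inj /(congr1 (fun v : tangent p => v : Cinf M -> R)) S0 j.
  (* Applied to [y j], the vanishing combination reduces to [a j * l]. *)
  have := congr1 (@^~ (y j)) S0; rewrite /= tangent_sum.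
  rewrite (bigD1 j) //= big1 ?addr0 => [|i ij]; last first.
    by rewrite Xy (negbTE ij) !mulr0.
  rewrite Xy eqxx mulr1 => /eqP; rewrite mulf_eq0 (negbTE l0) orbF => /eqP ->.
  by [].
have : basis_of (Eb s p) b.
  rewrite basisEfree fb dim_eigenbundle size_tuple leqnn andbT /=.
  apply/span_subvP => _ /(@tnthP _ _ b)[i ->].
  by rewrite /b tnth_mktuple memv_pi.
move=> /coord_basis/(_ us) ->.
have [Z Zp] := vfield_comb p (fun i => coord b i u) X.
by exists Z; rewrite Zp Psum; apply: eq_bigr => i _; rewrite bE.
Qed.

Lemma torsion_in s (nb : connection (Eb s)) X Y p :
  torsion Phi nb X Y p \in Eb s p.
Proof. by rewrite /torsion !rpredB ?sec_in. Qed.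

(** * Conditions (iii) and (iv) in terms of the lowered torsions *)

Variables (np : connection (Eb Plus)) (nm : connection (Eb Minus)).
Hypothesis np_nm_dual : dual_connection np nm.
Implicit Types (X Y Z : vfield M) (p : M).

Local Notation Psec := (Phi_sec H Phi).

(** This and the next definition are T+ and T- of the opening comment. *)
Definition lower_torsion_plus X Y Z p : R :=
  tau p (torsion Phi np X Y p) (Psec Minus Z p).
Definition lower_torsion_minus X Y Z p : R :=
  tau p (Psec Plus Z p) (torsion Phi nm X Y p).

Lemma lower_torsion_plusE X Y Z p : lower_torsion_plus X Y Z p =
  tau p (np X (Psec Plus Y) p) (Psec Minus Z p)
  - tau p (np Y (Psec Plus X) p) (Psec Minus Z p)
  - tau p (Psec Plus (bracket X Y) p) (Psec Minus Z p).
Proof. by rewrite /lower_torsion_plus /torsion !metricBl. Qed.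

Lemma lower_torsion_minusE X Y Z p : lower_torsion_minus X Y Z p =
  tau p (Psec Plus Z p) (nm X (Psec Minus Y) p)
  - tau p (Psec Plus Z p) (nm Y (Psec Minus X) p)
  - tau p (Psec Plus Z p) (Psec Minus (bracket X Y) p).
Proof. by rewrite /lower_torsion_minus /torsion !metricBr. Qed.

(** The covariant derivative terms match one by one; the bracket terms of T- and T+ cancel by
    [Phi_sym]. *)
Lemma C_tensor_swap X Y Z p :
  C_tensor Phi np nm X Y Z p - C_tensor Phi np nm Y X Z p
  = 2 * (lower_torsion_minus X Y Z p - lower_torsion_plus X Y Z p).
Proof.
have := Phi_sym (bracket X Y p) (Z p).
rewrite /C_tensor lower_torsion_plusE lower_torsion_minusE /= => ->; ring.
Qed.

(** Duality expands the three derivatives of pairings, and the resulting terms regroup into the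
    lowered torsions. *)
Lemma kossowskiE X Y Z p : kossowski H Phi X Y Z p =
  tau p (np X (Psec Plus Y) p) (Psec Minus Z p)
  + tau p (Psec Plus Z p) (nm X (Psec Minus Y) p)
  + (lower_torsion_plus Y Z X p - lower_torsion_minus X Y Z p
     - lower_torsion_minus Z X Y p).
Proof.
have pair_sym : pairing H (Psec Plus X) (Psec Minus Y)
    = pairing H (Psec Plus Y) (Psec Minus X).
  by apply/val_inj/funext => q; exact: Phi_sym.
(* The torsions contain the expansion of the [Z]-derivative with [X] and [Y] exchanged; [dual]
   equates the two expansions. *)
have := np_nm_dual Z (Psec Plus X) (Psec Minus Y) p.
have := np_nm_dual Z (Psec Plus Y) (Psec Minus X) p.
rewrite -pair_sym => -> dual.
have := Phi_sym (bracket Y Z p) (X p).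
rewrite /kossowski !np_nm_dual lower_torsion_plusE !lower_torsion_minusE /=.
rewrite /= in dual.
move: dual; lra.
Qed.

(** The torsion of [np] lies in E+ and is tested against E-, so it is [Phi-] that has to reach every
    vector. *)
Lemma torsion_free_plus : Phi_injective Minus ->
  (forall X Y Z p, lower_torsion_plus X Y Z p = 0) -> torsion_free Phi np.
Proof.
move=> inj T0 X Y p; apply: (eigen_nondegenerate (torsion_in _ _ _ _)) => w ws.
by have [Z <-] := Phi_fields_surjective inj ws; exact: T0.
Qed.

Lemma torsion_free_minus : Phi_injective Plus ->
  (forall X Y Z p, lower_torsion_minus X Y Z p = 0) -> torsion_free Phi nm.
Proof.
move=> inj T0 X Y p; apply: (eigen_nondegenerate (torsion_in _ _ _ _)) => w ws.
have [Z <-] := Phi_fields_surjective inj ws.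
by rewrite Defs.metric_sym; exact: T0.
Qed.

Lemma lower_torsion_plus_free X Y Z p :
  torsion_free Phi np -> lower_torsion_plus X Y Z p = 0.
Proof. by move=> T0; rewrite /lower_torsion_plus T0 metric0l. Qed.

Lemma lower_torsion_minus_free X Y Z p :
  torsion_free Phi nm -> lower_torsion_minus X Y Z p = 0.
Proof. by move=> T0; rewrite /lower_torsion_minus T0 metric0r. Qed.

Lemma C_symmetricP :
  C_symmetric Phi np nm <->
  forall X Y Z p, lower_torsion_plus X Y Z p = lower_torsion_minus X Y Z p.
Proof.
split=> S X Y Z p; have := C_tensor_swap X Y Z p; rewrite S; lra.
Qed.

Lemma kossowski_formulaP : kossowski_formula Phi np nm <->
  forall X Y Z p, lower_torsion_plus Y Z X p =
    lower_torsion_minus X Y Z p + lower_torsion_minus Z X Y p.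
Proof. by split=> S X Y Z p; have := kossowskiE X Y Z p; rewrite S; lra. Qed.

End ParaHermitianAlgebra.

Theorem proposition3p19 (R : realType) (n : nat) (M : manifold R n)
    (E : vbundle M (2 * n)) (H : para_hermitian E)
    (Phi : bundle_map E) (Phi_lagrangian : lagrangian_image H Phi)
    (np : connection (eigenbundle (pcx H) Plus))
    (nm : connection (eigenbundle (pcx H) Minus))
    (np_nm_dual : dual_connection np nm) :
  let i := torsion_free Phi np in
  let ii := torsion_free Phi nm in
  let iii := C_symmetric Phi np nm in
  let iv := kossowski_formula Phi np nm in
  [/\ i /\ ii -> iii /\ iv,
      Phi_iso H Phi Plus -> i -> iii \/ iv -> ii,
      Phi_iso H Phi Minus -> ii -> iii \/ iv -> i &
      h_nondegenerate H Phi ->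
        [\/ i /\ ii, i /\ iii | i /\ iv] \/
        [\/ ii /\ iii, ii /\ iv | iii /\ iv] ->
        [/\ i, ii, iii & iv]].
Proof.
move=> i ii iii iv.
have iiiP := C_symmetricP Phi_lagrangian np nm.
have ivP := kossowski_formulaP Phi_lagrangian np_nm_dual.
have free_sym : i /\ ii -> iii /\ iv.
  move=> [i0 ii0]; split; [apply/iiiP|apply/ivP] => X Y Z p.
    by rewrite lower_torsion_plus_free ?lower_torsion_minus_free.
  by rewrite lower_torsion_plus_free ?lower_torsion_minus_free ?addr0.
have plus_minus : Phi_injective H Phi Plus -> i -> iii \/ iv -> ii.
  move=> inj i0 s; apply: torsion_free_minus inj _ => X Y Z p.
  have Tp0 X' Y' Z' := lower_torsion_plus_free X' Y' Z' p i0.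
  case: s => [/iiiP <- // | /ivP s].
  (* With T+ = 0, (iv) says that any two of the three cyclic values of T- add up to 0, so all three
     vanish. *)
  have := s X Y Z p; have := s Z X Y p; have := s Y Z X p; rewrite !Tp0; lra.
have minus_plus : Phi_injective H Phi Minus -> ii -> iii \/ iv -> i.
  move=> inj ii0 s; apply: torsion_free_plus inj _ => X Y Z p.
  have Tm0 X' Y' Z' := lower_torsion_minus_free X' Y' Z' p ii0.
  by case: s => [/iiiP | /ivP] ->; rewrite !Tm0 ?addr0.
have sym_plus : Phi_injective H Phi Minus -> iii -> iv -> i.
  move=> inj /iiiP s3 /ivP s4; apply: torsion_free_plus inj _ => X Y Z p.
  (* With T+ = T-, (iv) makes each of the three cyclic values the sum of the other two. Their total
     is then 0, and so is each value. *)
  have := s4 X Y Z p; have := s4 Z X Y p; have := s4 Y Z X p; rewrite !s3; lra.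
split=> //.
- by move=> /Phi_iso_injective; exact: plus_minus.
- by move=> /Phi_iso_injective; exact: minus_plus.
move=> nd.
have ip := h_nondegenerate_injective Phi_lagrangian (s := Plus) nd.
have im := h_nondegenerate_injective Phi_lagrangian (s := Minus) nd.
have all : i /\ ii -> [/\ i, ii, iii & iv].
  by move=> f; have [? ?] := free_sym f; case: f.
move=> [] [] [a b]; apply: all; split=> //.
- by apply: plus_minus => //; left.
- by apply: plus_minus => //; right.
- by apply: minus_plus => //; left.
- by apply: minus_plus => //; right.
- exact: sym_plus.
(* From (iii) and (iv) comes (i) first, and then (ii) from (i) and (iii). *)
- by apply: plus_minus => //; [exact: sym_plus|left].
Qed.
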